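(* Let $n,B\in\mathbb{N}$ with $B\le n$ and let $f_j=1/j$ for $j\in[n]$. Let $h:[n]\to[B]$ and $s:[n]\to\{-1,1\}$ be independent, truly (uniformly) random hash functions. For $i\in[n]$ define $\tilde f_i=\sum_{j\in[n]}[h(j)=h(i)]\,s(j)\,f_j$. Then for every $i\in[n]$, $$\mathbb{E}\big[|\tilde f_i-s(i)f_i|\big]=\Theta\!\left(\frac{\log B}{B}\right).$$
   Context: $[E]$ denotes the indicator of the event $E$. This is Count-Sketch with a single hash function on Zipfian frequencies $f_j=1/j$.
   Formalization: The formal statement assumes B ≥ 2, because at B = 1 the bound log B / B is 0 while the expected error is positive for n ≥ 2; Θ is taken with absolute constants uniform in n, B and i. *)

(* Defs.v *)
From HB Require Import structures.
From mathcomp Require Import all_boot all_order all_algebra.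
From mathcomp Require Import all_classical all_reals all_analysis.

Set Implicit Arguments.
Unset Strict Implicit.
Unset Printing Implicit Defensive.

Import Order.TTheory GRing.Theory Num.Theory.

Local Open Scope classical_set_scope.
Local Open Scope ring_scope.

(* A random element of a finite type (with the discrete sigma-algebra) that is
   uniformly distributed. For A a type of functions this is a truly random
   hash function. *)
Definition uniform_random (d : measure_display) (T : measurableType d)
    (R : realType) (P : probability T R) (A : finType) (X : T -> A) : Prop :=
  (forall E : set A, measurable (X @^-1` E)) /\
  (forall a : A, P (X @^-1` [set a]) = ((#|A|%:R)^-1)%:E).

Definition independent_random (d : measure_display) (T : measurableType d)
    (R : realType) (P : probability T R) (A B : finType)
    (X : T -> A) (Y : T -> B) : Prop :=
  forall (E : set A) (F : set B),
    P (X @^-1` E `&` Y @^-1` F) = (P (X @^-1` E) * P (Y @^-1` F))%E.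

(* The ordinal j : 'I_n stands for the item j + 1 of [n] = {1, ..., n}. *)
Definition zipf (R : realType) (n : nat) (j : 'I_n) : R := (j.+1%:R)^-1.

(* Random signs are encoded as booleans: false is 1 and true is -1. *)
Definition sgn (R : realType) (b : bool) : R := (-1) ^+ b.

Definition count_sketch (R : realType) (n B : nat) (f : 'I_n -> R)
    (h : {ffun 'I_n -> 'I_B}) (s : {ffun 'I_n -> bool}) (i : 'I_n) : R :=
  \sum_(j < n) (h j == h i)%:R * sgn R (s j) * f j.

(* Main.v *)
(** Write X for the sum of the colliding terms s(j) f_j over j <> i, so that the
    error is |X|.

    Upper bound: split X at j = B. The head contributes at most the sum of
    f_j Pr[h(j) = h(i)] = f_j / B, that is H_B / B. The signs are orthogonal, so
    the second moment of the tail Y is the sum over j > B of f_j^2 / B, at most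
    1 / B^2; hence E|Y| <= 1 / B.

    Lower bound: E|X| >= E[X g] whenever |g| <= 1. Let S be the set of items
    j <> i among the first B/2 + 1, and let g be the sign of the colliding item
    of S if there is exactly one, and 0 otherwise. By orthogonality E[X g] is the
    sum over j in S of f_j times the probability that j is the only item of S to
    collide, and by Bonferroni this probability is at least
    1/B - (|S| - 1) / B^2 >= 1 / (2B). *)

Require Import Defs.
From HB Require Import structures.
From mathcomp Require Import all_boot all_order all_algebra.
From mathcomp Require Import all_classical all_reals all_analysis.
From mathcomp Require Import measurable_realfun ring lra zify.

Set Implicit Arguments.
Unset Strict Implicit.
Unset Printing Implicit Defensive.

Import Order.TTheory GRing.Theory Num.Theory.

Local Open Scope classical_set_scope.
Local Open Scope ring_scope.

(** * Uniform expectations as finite averages *)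

Definition avg (R : realType) (A : finType) (F : A -> R) : R :=
  #|A|%:R^-1 * \sum_a F a.

Section Avg.
Context {R : realType} {A : finType}.
Implicit Types F G : A -> R.

Lemma eq_avg F G : F =1 G -> avg F = avg G.
Proof. by move=> FG; rewrite /avg; congr (_ * _); apply: eq_bigr. Qed.

Lemma le_avg F G : (forall a, F a <= G a) -> avg F <= avg G.
Proof.
by move=> FG; rewrite /avg ler_wpM2l ?invr_ge0// ler_sum// => a _.
Qed.

Lemma avgD F G : avg (fun a => F a + G a) = avg F + avg G.
Proof. by rewrite /avg big_split/= mulrDr. Qed.

Lemma avgZl (c : R) F : avg (fun a => c * F a) = c * avg F.
Proof. by rewrite /avg -mulr_sumr mulrCA. Qed.

Lemma avg_sum (I : finType) (P : pred I) (F : I -> A -> R) :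
  avg (fun a => \sum_(i | P i) F i a) = \sum_(i | P i) avg (F i).
Proof. by rewrite /avg exchange_big/= mulr_sumr. Qed.

Lemma avgB F G : avg (fun a => F a - G a) = avg F - avg G.
Proof. by rewrite /avg sumrB mulrBr. Qed.

Lemma avg_cst (c : R) : (0 < #|A|)%N -> avg (fun _ : A => c) = c.
Proof.
move=> A0; rewrite /avg sumr_const -[c *+ _]mulr_natl mulKf//.
by rewrite pnatr_eq0 -lt0n.
Qed.

Lemma avg_delta (a : A) : avg (fun b => (b == a)%:R : R) = #|A|%:R^-1.
Proof.
rewrite /avg (bigD1 a)//= eqxx big1 ?addr0 ?mulr1// => b /negPf ->//.
Qed.

(** The values of a uniform random function are independent: expanding a product of sums over [A]
    enumerates the functions from [I] to [A]. Indices outside [P] carry the constant 1, whose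
    average is 1 because [A] is nonempty. *)
Lemma avg_prod (I : finType) (P : pred I) (F : I -> A -> R) : (0 < #|A|)%N ->
  avg (fun f : {ffun I -> A} => \prod_(x | P x) F x (f x)) =
  \prod_(x | P x) avg (F x).
Proof.
move=> A0; rewrite [RHS]big_mkcond/=.
transitivity (\prod_x avg (fun a => if P x then F x a else 1)); last first.
  by apply: eq_bigr => x _; case: ifP => // _; rewrite avg_cst.
rewrite /avg big_split/= prodr_const bigA_distr_bigA/=.
rewrite card_ffun natrX exprVn; congr (_ * _).
by apply: eq_bigr => f _; rewrite big_mkcond.
Qed.

End Avg.

Lemma avg_collision (R : realType) (n B : nat) (i : 'I_n) (X : {set 'I_n}) :
  (0 < B)%N -> i \notin X ->
  avg (fun h : {ffun 'I_n -> 'I_B} => \prod_(j in X) (h j == h i)%:R : R) =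
  B%:R^-1 ^+ #|X|.
Proof.
move=> B0 iX.
(* Split according to the bucket [a] of [i]: adding [i] to [X] kills every term but [a = h i]. Now
   the target bucket is fixed, so the product factors, and the B choices of [a] cancel the extra
   factor 1/B. *)
transitivity (avg (fun h : {ffun 'I_n -> 'I_B} =>
    \sum_(a : 'I_B) \prod_(j in (i |: X)%SET) (h j == a)%:R : R)).
  apply: eq_avg => h; rewrite (bigD1 (h i))//= big_setU1//= eqxx mul1r.
  rewrite [X in _ = _ + X]big1 ?addr0// => a ai.
  by rewrite big_setU1//= eq_sym (negPf ai) mul0r.
rewrite avg_sum.
under eq_bigr => a _.
  rewrite (avg_prod _ (fun _ b => (b == a)%:R)) ?card_ord//.
  rewrite prodr_const avg_delta card_ord cardsU1 iX add1n exprS.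
  over.
rewrite sumr_const card_ord -[LHS]mulr_natl mulVKf//.
by rewrite pnatr_eq0 -lt0n.
Qed.

(** * Orthogonality of random signs *)

Section Signs.
Context {R : realType} {n : nat}.
Implicit Types (s : {ffun 'I_n -> bool}) (P : pred 'I_n).

Lemma avg_sgnM (j k : 'I_n) :
  avg (fun s => sgn R (s j) * sgn R (s k)) = (j == k)%:R.
Proof.
have [->|jk] := eqVneq j k.
  rewrite -[RHS](@avg_cst R {ffun 'I_n -> bool}); last first.
    by rewrite card_ffun card_bool expn_gt0.
  by apply: eq_avg => s; rewrite /sgn -expr2 sqrr_sign.
transitivity (avg (fun s => \prod_(x in [set j; k]%SET) sgn R (s x))).
  apply: eq_avg => s.
  by rewrite big_setU1 ?inE//= big_set1.
rewrite (avg_prod _ (fun _ => sgn R)) ?card_bool// big_setU1 ?inE//=.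
rewrite /avg big_bool /sgn/= expr0 expr1 addNr mulr0 mul0r//.
Qed.

(** Only the diagonal of the double sum survives. With [a = b] this gives second moments; with [b] a
    test function it gives the lower bound. *)
Lemma avg_sgn_orth P (a b : 'I_n -> R) :
  avg (fun s => (\sum_(j | P j) a j * sgn R (s j)) *
                (\sum_(j | P j) b j * sgn R (s j))) =
  \sum_(j | P j) a j * b j.
Proof.
under eq_avg => s.
  rewrite big_distrlr/=; under eq_bigr => j _.
    under eq_bigr => k _ do rewrite mulrACA.
    over.
  over.
rewrite avg_sum; apply: eq_bigr => j Pj; rewrite avg_sum (bigD1 j)//=.
rewrite avgZl avg_sgnM eqxx mulr1 big1 ?addr0// => k /andP[_ kj].
by rewrite avgZl avg_sgnM eq_sym (negPf kj) mulr0.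
Qed.

Lemma norm_sgn_sum P (a : 'I_n -> R) s : (forall j, P j -> 0 <= a j) ->
  `|\sum_(j | P j) a j * sgn R (s j)| <= \sum_(j | P j) a j.
Proof.
move=> a0; apply: le_trans (ler_norm_sum _ _ _) _.
by apply: ler_sum => j Pj; rewrite normrM normr_sign mulr1 ger0_norm ?a0.
Qed.

End Signs.

(** * Harmonic sums and the logarithm *)

Section Harmonic.
Context {R : realType}.

(** Here ln (1 + x) <= x is taken at x = 1/(k+1); [ln_succ_lb] takes it at x = -1/(k+2). Summed over
    k, the differences telescope. *)
Lemma ln_succ_ub (k : nat) : ln k.+2%:R - ln k.+1%:R <= k.+1%:R^-1 :> R.
Proof.
rewrite -ln_div ?posrE ?ltr0n// -[X in X / _]natr1 mulrDl divff ?pnatr_eq0//.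
by rewrite mul1r le_ln1Dx// (@lt_trans _ _ 0)// ?ltrN10 ?invr_gt0 ?ltr0n.
Qed.

Lemma ln_succ_lb (k : nat) : k.+2%:R^-1 <= ln k.+2%:R - ln k.+1%:R :> R.
Proof.
rewrite -lerN2 opprB -ln_div ?posrE ?ltr0n//.
have -> : k.+1%:R / k.+2%:R = 1 + - k.+2%:R^-1 :> R.
  by rewrite -[k.+2%:R]natr1 -{1}[k.+1%:R](addrK 1) mulrBl divff ?mul1r// natr1 pnatr_eq0.
by rewrite le_ln1Dx// ltrN2 invf_lt1 ?ltr0n// ltr1n.
Qed.

Lemma ln_le_harmonic (m : nat) : ln m.+1%:R <= \sum_(j < m) j.+1%:R^-1 :> R.
Proof.
elim: m => [|m IH]; first by rewrite big_ord0 ln1.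
rewrite big_ord_recr/=; apply: le_trans (lerD IH (ln_succ_ub m)).
by rewrite addrC subrK.
Qed.

Lemma harmonic_le_ln (m : nat) :
  \sum_(j < m.+1) j.+1%:R^-1 <= 1 + ln m.+1%:R :> R.
Proof.
elim: m => [|m IH]; first by rewrite big_ord_recr big_ord0/= ln1 invr1 add0r addr0.
rewrite big_ord_recr/=; apply: le_trans (lerD IH (ln_succ_lb m)) _.
by rewrite -addrA [ln m.+1%:R + _]addrC subrK.
Qed.

Lemma sum_inv_sqr_tail (b m : nat) : (0 < b)%N -> (b <= m)%N ->
  \sum_(b <= j < m) j.+1%:R^-1 ^+ 2 <= b%:R^-1 - m%:R^-1 :> R.
Proof.
move=> b0; elim: m => [|m IH]; first by rewrite leqn0 => /eqP b0'; rewrite b0' in b0.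
rewrite leq_eqVlt => /orP[/eqP <-|]; first by rewrite big_geq// subrr.
rewrite ltnS => bm; rewrite big_nat_recr//=.
have m0 : 0 < m%:R :> R by rewrite ltr0n (leq_trans b0).
(* Telescoping: 1/(m+1)^2 <= 1/(m(m+1)) = 1/m - 1/(m+1). *)
have : m.+1%:R^-1 ^+ 2 <= m%:R^-1 - m.+1%:R^-1 :> R.
  have -> : m%:R^-1 - m.+1%:R^-1 = m%:R^-1 * m.+1%:R^-1 :> R.
    rewrite -[m%:R^-1 in LHS](mulfK (_ : m.+1%:R != 0)) ?pnatr_eq0//.
    by rewrite -natr1 mulrDr mulVf ?gt_eqF// mulr1 mulrDl mul1r addrC addKr.
  by rewrite expr2 ler_wpM2r// lef_pV2 ?posrE ?ltr0Sn// ler_nat.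
by move=> h; apply: le_trans (lerD (IH bm) h) _; rewrite addrA subrK.
Qed.

End Harmonic.

(** * From the probability space to finite averages *)

Lemma expectation_avg (d : measure_display) (T : measurableType d)
    (R : realType) (P : probability T R) (A B : finType)
    (X : T -> A) (Y : T -> B) (G : A -> B -> R) :
  uniform_random P X -> uniform_random P Y -> independent_random P X Y ->
  (forall a b, 0 <= G a b) ->
  'E_P[fun w => G (X w) (Y w)]%E = (avg (fun a => avg (G a)))%:E.
Proof.
move=> [mX uX] [mY uY] XY G0; rewrite unlock.
(* The events [E p] partition the space, so the integrand is a finite combination of their
   indicators; independence and uniformity give each of them mass 1/(|A||B|). *)
pose E (p : A * B) := X @^-1` [set p.1] `&` Y @^-1` [set p.2].
have mE p : measurable (E p) by apply: measurableI.
transitivity (\int[P]_w (\sum_p (G p.1 p.2)%:E * (\1_(E p) w)%:E))%E.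
  apply: eq_integral => w _; rewrite (bigD1 (X w, Y w))//= indicE mem_set//= mule1.
  rewrite big1 ?adde0// => -[a b]/= /eqP ab.
  rewrite indicE memNset ?mule0// => -[/= aw bw]; apply: ab.
  by rewrite aw bw.
rewrite ge0_integral_sum//; last 2 first.
- move=> p; apply/measurable_EFinP; apply: measurable_funM => //.
- by move=> p w _; rewrite mule_ge0// lee_fin.
transitivity (\sum_(p : A * B) (G p.1 p.2 * (#|A|%:R^-1 * #|B|%:R^-1))%:E)%E.
  apply: eq_bigr => p _.
  rewrite ge0_integralZl_EFin//; last exact/measurable_EFinP.
  rewrite integral_indic// setIT EFinM; congr (_ * _)%E.
  by apply: (etrans (XY [set p.1] [set p.2])); rewrite uX uY.
rewrite sumEFin -(pair_bigA _ (fun a b => G a b * (#|A|%:R^-1 * #|B|%:R^-1)))/=.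
congr EFin; rewrite /avg mulr_sumr; apply: eq_bigr => a _.
by rewrite -mulr_suml mulrA mulrC.
Qed.

Lemma count_sketch_err (R : realType) (n B : nat) (f : 'I_n -> R)
    (h : {ffun 'I_n -> 'I_B}) (s : {ffun 'I_n -> bool}) (i : 'I_n) :
  count_sketch f h s i - sgn R (s i) * f i =
  \sum_(j | j != i) (h j == h i)%:R * f j * sgn R (s j).
Proof.
rewrite /count_sketch (bigD1 i)//= eqxx mul1r addrAC subrr add0r.
by apply: eq_bigr => j _; rewrite mulrAC.
Qed.

(** * Collision noise for arbitrary nonnegative frequencies *)

Section Noise.
Context {R : realType} {n B : nat} (f : 'I_n -> R) (i : 'I_n).
Hypothesis f_ge0 : forall j, 0 <= f j.
Hypothesis B_gt0 : (0 < B)%N.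
Implicit Types (h : {ffun 'I_n -> 'I_B}) (s : {ffun 'I_n -> bool}).

Let c h j : R := (h j == h i)%:R.

(** The predicate [P] lets the same estimates serve the whole error ([j != i]), its head and its
    tail. *)
Definition noise (P : pred 'I_n) h s : R :=
  \sum_(j | P j) (h j == h i)%:R * f j * sgn R (s j).

Lemma card_signs_gt0 : (0 < #|{ffun 'I_n -> bool}|)%N.
Proof. by rewrite card_ffun card_bool expn_gt0. Qed.

Lemma card_hashes_gt0 : (0 < #|{ffun 'I_n -> 'I_B}|)%N.
Proof. by rewrite card_ffun card_ord expn_gt0 B_gt0. Qed.

Lemma avg_collision1 j : j != i -> avg (c^~ j) = B%:R^-1.
Proof.
move=> ji; rewrite -[RHS]expr1 -(cards1 j).
rewrite -(avg_collision R (i := i)) ?inE 1?eq_sym//.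
by apply: eq_avg => h; rewrite big_set1.
Qed.

Lemma avg_collision2 j k : j != i -> k != i -> j != k ->
  avg (fun h => c h j * c h k) = B%:R^-1 ^+ 2.
Proof.
move=> ji ki jk; have <- : #|[set j; k]%SET| = 2%N by rewrite cards2 jk.
rewrite -(avg_collision R (i := i)) ?inE 1?eq_sym ?negb_or ?(negPf ji) 1?eq_sym//.
by apply: eq_avg => h; rewrite big_setU1 ?inE//= big_set1.
Qed.

(** The triangle inequality discards the signs. This is meant for the head of the Zipf sequence,
    whose squared frequencies sum to order 1 rather than 1/B, too much for the second-moment
    bound. *)
Lemma avg_norm_noise_ub (P : pred 'I_n) : (forall j, P j -> j != i) ->
  avg (fun h => avg (fun s => `|noise P h s|)) <= B%:R^-1 * \sum_(j | P j) f j.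
Proof.
move=> Pi; apply: le_trans (_ : avg (fun h => \sum_(j | P j) f j * c h j) <= _).
  apply: le_avg => h; rewrite -[leRHS](avg_cst _ card_signs_gt0).
  apply: le_avg => s.
  have -> : \sum_(j | P j) f j * c h j = \sum_(j | P j) c h j * f j.
    by apply: eq_bigr => j _; rewrite mulrC.
  by apply: norm_sgn_sum => j _; rewrite mulr_ge0// ler0n.
rewrite avg_sum mulr_sumr; apply: ler_sum => j Pj.
by rewrite avgZl avg_collision1 ?Pi// mulrC.
Qed.

Lemma avg_sqr_noise (P : pred 'I_n) : (forall j, P j -> j != i) ->
  avg (fun h => avg (fun s => noise P h s ^+ 2)) =
  B%:R^-1 * \sum_(j | P j) f j ^+ 2.
Proof.
move=> Pi; transitivity (avg (fun h => \sum_(j | P j) f j ^+ 2 * c h j)).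
  apply: eq_avg => h; under eq_avg do rewrite expr2.
  rewrite avg_sgn_orth; apply: eq_bigr => j _.
  by rewrite mulrACA -natrM mulnb andbb mulrC.
rewrite avg_sum mulr_sumr; apply: eq_bigr => j Pj.
by rewrite avgZl avg_collision1 ?Pi// mulrC.
Qed.

(* AM-GM: |y| <= (B y^2 + 1/B) / 2. *)
Lemma avg_norm_noise_sqr_ub (P : pred 'I_n) : (forall j, P j -> j != i) ->
  avg (fun h => avg (fun s => `|noise P h s|)) <=
  2^-1 * (\sum_(j | P j) f j ^+ 2 + B%:R^-1).
Proof.
move=> Pi; have B0 : 0 < B%:R :> R by rewrite ltr0n.
have -> : 2^-1 * (\sum_(j | P j) f j ^+ 2 + B%:R^-1) =
    avg (fun h => avg (fun s => 2^-1 * B%:R * noise P h s ^+ 2 + 2^-1 * B%:R^-1)).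
  under eq_avg do rewrite avgD avgZl (avg_cst _ card_signs_gt0).
  rewrite avgD avgZl (avg_cst _ card_hashes_gt0) avg_sqr_noise//.
  by rewrite mulrDr -mulrA [_ * (_ * \sum_(j | _) _)]mulrA mulfV ?mul1r ?gt_eqF.
apply: le_avg => h; apply: le_avg => s.
set y := noise P h s; set b : R := B%:R in B0 *.
rewrite -subr_ge0 -(real_normK (num_real y)).
have -> : 2^-1 * b * `|y| ^+ 2 + 2^-1 * b^-1 - `|y| =
   2^-1 * b^-1 * (b * `|y| - 1) ^+ 2 by field; rewrite gt_eqF.
by rewrite mulr_ge0 ?sqr_ge0// mulr_ge0// invr_ge0 ltW.
Qed.

(* Test the noise against the sign of the unique colliding item of S:
   E|X| >= E[X g] for every |g| <= 1, and only the diagonal survives in E[X g]. *)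
Lemma avg_norm_noise_lb_hash (P : pred 'I_n) (S : {set 'I_n}) h :
  (forall j, j \in S -> P j) ->
  \sum_(j in S) f j * (c h j - \sum_(k in S | k != j) c h j * c h k) <=
  avg (fun s => `|noise P h s|).
Proof.
move=> SP; set N := (\sum_(j in S) (h j == h i))%N.
(* [b] marks the colliding item of [S] when [N = 1] and vanishes otherwise. Its total is [N = 1] N
   <= 1, so the test function is bounded by 1 for every choice of signs. *)
pose b j : R := (N == 1%N)%:R * (j \in S)%:R * c h j.
have b0 j : 0 <= b j by rewrite /b !mulr_ge0 ?ler0n.
have sum_b : \sum_(j | P j) b j <= 1.
  have -> : \sum_(j | P j) b j = (N == 1%N)%:R * N%:R.
    rewrite /N natr_sum mulr_sumr [in LHS]big_mkcond [in RHS]big_mkcond/=.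
    apply: eq_bigr => j _; rewrite /b; have [jS|jS] := boolP (j \in S).
      by rewrite SP// mulr1.
    by case: ifP => // _; rewrite mulr0 mul0r.
  by case: eqP => [->|_]; rewrite ?mulr1// mul0r ler01.
apply: le_trans (_ : avg (fun s => noise P h s *
    \sum_(j | P j) b j * sgn R (s j)) <= _); last first.
  apply: le_avg => s; apply: le_trans (ler_norm _) _; rewrite normrM ler_piMr//.
  exact: le_trans (norm_sgn_sum _ _) _.
rewrite avg_sgn_orth.
have -> : \sum_(j | P j) (h j == h i)%:R * f j * b j =
    \sum_(j in S) f j * ((N == 1%N)%:R * c h j).
  rewrite [in LHS]big_mkcond [in RHS]big_mkcond/=.
  apply: eq_bigr => j _; rewrite /b; have [jS|jS] := boolP (j \in S).
    rewrite SP// mulr1 /c; case: (h j == h i); rewrite ?mul1r ?mulr1//.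
    by rewrite !mulr0.
  by case: ifP => // _; rewrite !(mulr0, mul0r).
apply: ler_sum => j jS; rewrite ler_wpM2l// -mulr_sumr /c.
have [hj|hj] := eqVneq (h j) (h i); last by rewrite mul0r mulr0 subr0.
rewrite !mul1r mulr1.
(* If M other items of [S] collide, what remains is [M = 0] >= 1 - M, the pointwise form of
   Bonferroni. *)
have NE : N = (1 + \sum_(k in S | k != j) (h k == h i))%N.
  by rewrite /N (bigD1 j)//= hj eqxx.
rewrite -natr_sum NE -[X in (_ + _ == X)%N]addn0 eqn_add2l.
case: (\sum_(k in S | k != j) _)%N => [|m]; first by rewrite subr0.
by rewrite -natr1 opprD addrCA subrr addr0 oppr_le0 ler0n.
Qed.

Lemma avg_norm_noise_lb (P : pred 'I_n) (S : {set 'I_n}) :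
  (forall j, j \in S -> P j) -> i \notin S -> (#|S|.-1.*2 <= B)%N ->
  (2 * B%:R)^-1 * \sum_(j in S) f j <=
  avg (fun h => avg (fun s => `|noise P h s|)).
Proof.
move=> SP iS SB; have B0 : 0 < B%:R :> R by rewrite ltr0n.
have Si j : j \in S -> j != i by apply: contraTneq => ->.
apply: le_trans (le_avg (fun h => avg_norm_noise_lb_hash h SP)).
rewrite avg_sum mulr_sumr; apply: ler_sum => j jS.
rewrite avgZl mulrC ler_wpM2l// avgB avg_collision1 ?Si// avg_sum.
rewrite (eq_bigr (fun=> B%:R^-1 ^+ 2)); last first.
  by move=> k /andP[kS kj]; rewrite avg_collision2 ?Si// eq_sym.
rewrite sumr_const -[_ *+ _]mulr_natr.
have -> : #|[pred k in S | k != j]| = #|S|.-1.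
  rewrite (cardsD1 j S) jS/= -cardsE; apply: eq_card => k.
  by rewrite !inE andbC.
set m : R := #|S|.-1%:R.
(* The size condition on [S] makes the pair correction m/B^2 at most 1/(2B), half of the main term
   1/B. *)
have mB : 2 * m <= B%:R by rewrite /m -natrM ler_nat mul2n.
have u0 : 0 <= B%:R^-1 ^+ 2 :> R by rewrite exprn_ge0// invr_ge0 ltW.
have := ler_wpM2l u0 mB.
have -> : B%:R^-1 ^+ 2 * B%:R = B%:R^-1 :> R.
  by rewrite expr2 -mulrA mulVf ?mulr1// gt_eqF.
rewrite invfM; set u := B%:R^-1 ^+ 2; lra.
Qed.

End Noise.

(** * Zipfian frequencies *)

Section ZipfNoise.
Context {R : realType} {n B : nat} (i : 'I_n).
Hypotheses (B_ge2 : (2 <= B)%N) (Bn : (B <= n)%N).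

Let zipf_ge0 (j : 'I_n) : 0 <= zipf R j.
Proof. by rewrite /zipf invr_ge0. Qed.

Lemma sum_zipf_head (m : nat) : (m <= n)%N ->
  \sum_(j < n | (j < m)%N) zipf R j = \sum_(j < m) j.+1%:R^-1.
Proof. by move=> mn; rewrite (big_ord_widen n (fun j => j.+1%:R^-1)). Qed.

Lemma sum_zipf_sqr_tail :
  \sum_(j < n | (B <= j)%N) zipf R j ^+ 2 <= B%:R^-1.
Proof.
have B0 : (0 < B)%N by apply: leq_trans B_ge2.
have -> : \sum_(j < n | (B <= j)%N) zipf R j ^+ 2 =
    \sum_(B <= j < n) j.+1%:R^-1 ^+ 2.
  by rewrite big_geq_mkord; apply: eq_bigr.
apply: le_trans (sum_inv_sqr_tail B0 Bn) _.
by rewrite gerBl invr_ge0.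
Qed.

Lemma avg_zipf_noise_ub :
  avg (fun h : {ffun 'I_n -> 'I_B} => avg (fun s =>
    `|noise (@zipf R n) i (fun j => j != i) h s|)) <=
  (1 + 2 / ln 2) * (ln B%:R / B%:R).
Proof.
have B0 : (0 < B)%N by apply: leq_trans B_ge2.
have b0 : 0 < B%:R^-1 :> R by rewrite invr_gt0 ltr0n.
pose H (j : 'I_n) := (j != i) && (j < B)%N.
pose T (j : 'I_n) := (j != i) && ~~ (j < B)%N.
have Hi j : H j -> j != i by case/andP.
have Ti j : T j -> j != i by case/andP.
apply: le_trans (_ : avg (fun h : {ffun 'I_n -> 'I_B} =>
    avg (fun s => `|noise (@zipf R n) i H h s|) +
    avg (fun s => `|noise (@zipf R n) i T h s|)) <= _).
  apply: le_avg => h; rewrite -avgD; apply: le_avg => s.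
  by rewrite {1}/noise (bigID (fun j : 'I_n => (j < B)%N))/= ler_normD.
rewrite avgD.
have uH := avg_norm_noise_ub zipf_ge0 B0 Hi.
have uT := avg_norm_noise_sqr_ub (@zipf R n) B0 Ti.
have sH : \sum_(j | H j) zipf R j <= 1 + ln B%:R.
  apply: le_trans (_ : \sum_(j < n | (j < B)%N) zipf R j <= _).
    rewrite /H big_mkcondl; apply: ler_sum => j _.
    by case: ifP.
  by rewrite sum_zipf_head// -(prednK B0) harmonic_le_ln.
have sT : \sum_(j | T j) zipf R j ^+ 2 <= B%:R^-1.
  apply: le_trans sum_zipf_sqr_tail.
  rewrite /T (eq_bigl (fun j => (j != i) && (B <= j)%N)); last by move=> j; rewrite -leqNgt.
  rewrite big_mkcondl; apply: ler_sum => j _; case: ifP => // _.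
  exact: sqr_ge0.
have ln2 : 0 < ln 2 :> R by rewrite ln_gt0// ltr1n.
have lnB : ln 2 <= ln B%:R :> R by rewrite ler_ln ?posrE ?ltr0n// ler_nat.
(* Head and tail add up to (2 + ln B)/B; since B >= 2, the 2 is absorbed into (2 / ln 2) ln B, which
   gives the constant. *)
have lnB2 : 2 <= 2 / ln 2 * ln B%:R :> R.
  by rewrite -mulrA ler_peMr// mulrC ler_pdivlMr// mul1r.
have := ler_wpM2l (ltW b0) sH; have := ler_wpM2l (ltW b0) lnB2.
lra.
Qed.

Lemma avg_zipf_noise_lb :
  12^-1 * (ln B%:R / B%:R) <=
  avg (fun h : {ffun 'I_n -> 'I_B} => avg (fun s =>
    `|noise (@zipf R n) i (fun j => j != i) h s|)).
Proof.
have B0 : (0 < B)%N by apply: leq_trans B_ge2.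
have b0 : 0 < B%:R^-1 :> R by rewrite invr_gt0 ltr0n.
(* Small enough that 2(m - 1) <= B, yet (m + 1)^2 >= B, so that ln B <= 2 ln (m + 1) <= 2 [Hm]. *)
pose m := (B./2).+1.
have half_gt0 : (0 < B./2)%N by lia.
have mn : (m <= n)%N by apply: leq_trans Bn; rewrite /m; lia.
pose S : {set 'I_n} := [set j : 'I_n | (j != i) && (j < m)%N]%SET.
have Si j : j \in S -> j != i by rewrite inE => /andP[].
have iS : i \notin S by rewrite inE eqxx.
have cardS : (#|S| <= m)%N.
  rewrite -[X in (_ <= X)%N]card_ord.
  apply: leq_trans (_ : #|[set widen_ord mn k | k : 'I_m]%SET| <= _)%N; last first.
    exact: leq_imset_card.
  apply: subset_leq_card; apply/fintype.subsetP => j; rewrite inE => /andP[_ jm].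
  by apply/imsetP; exists (Ordinal jm) => //; exact: val_inj.
have SB : (#|S|.-1.*2 <= B)%N by move: cardS; rewrite /m; lia.
apply: le_trans (avg_norm_noise_lb zipf_ge0 B0 Si iS SB).
pose Hm : R := \sum_(j < m) j.+1%:R^-1.
(* As m >= 2, the first two terms give 3/2. Excluding [i] costs at most 1, and [Hm] >= 3/2 means
   [Hm] - 1 >= [Hm]/3. Hence ln B is at most 6 times the sum over [S], and the factor 1/(2B) turns 6
   into 12. *)
have Hm2 : 3 / 2 <= Hm.
  rewrite /Hm /m -(prednK half_gt0).
  rewrite !big_ord_recl/= addrA ler_wpDr ?sumr_ge0//; rewrite invr1 (_ : (bump 0 0).+1 = 2%N)//; lra.
have sS : Hm - 1 <= \sum_(j in S) zipf R j.
  rewrite /Hm -sum_zipf_head// lerBlDr.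
  have -> : \sum_(j in S) zipf R j = \sum_(j < n | (j < m)%N && (j != i)) zipf R j.
    by apply: eq_bigl => j; rewrite inE andbC.
  have [im|im] := boolP (i < m)%N.
    rewrite (bigD1 i)//= addrC lerD2l /zipf invf_le1 ?ltr0n// ler1n//.
  rewrite ler_wpDr// le_eqVlt; apply/orP; left; apply/eqP; apply: eq_bigl => j.
  by rewrite andb_idr// => jm; apply: contraNneq im => <-.
have lnm : ln B%:R <= 2 * Hm.
  apply: le_trans (_ : 2 * ln m.+1%:R <= _); last first.
    by rewrite ler_wpM2l// ln_le_harmonic.
  rewrite mulr_natl -lnXn ?ltr0n// ler_ln ?posrE ?exprn_gt0 ?ltr0n//.
  by rewrite -natrX ler_nat /m; nia.
rewrite invfM; have : ln B%:R <= 6 * \sum_(j in S) zipf R j by lra.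
move=> /(ler_wpM2l (ltW b0)); lra.
Qed.

End ZipfNoise.

Theorem theorem4p3 (R : realType) :
  exists c C : R, 0 < c /\ 0 < C /\
    forall (n B : nat), (2 <= B)%N -> (B <= n)%N ->
    forall (d : measure_display) (T : measurableType d) (P : probability T R)
           (h : T -> {ffun 'I_n -> 'I_B}) (s : T -> {ffun 'I_n -> bool}),
      uniform_random P h -> uniform_random P s -> independent_random P h s ->
    forall i : 'I_n,
      let err := fun w : T =>
        `| count_sketch (@zipf R n) (h w) (s w) i - sgn R (s w i) * zipf R i | in
      ((c * (ln B%:R / B%:R))%:E <= 'E_P[err])%E /\
      ('E_P[err] <= (C * (ln B%:R / B%:R))%:E)%E.
Proof.
have ln2 : 0 < ln 2 :> R by rewrite ln_gt0// ltr1n.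
exists 12^-1, (1 + 2 / ln 2); split; first by rewrite invr_gt0.
split; first by rewrite addr_gt0// divr_gt0.
move=> n B B2 Bn d T P h s uh us hs i err.
(* The item [i] always collides with itself, so its term cancels and the error is the noise over
   [j != i]. *)
pose G (a : {ffun 'I_n -> 'I_B}) (b : {ffun 'I_n -> bool}) : R :=
  `|noise (@zipf R n) i (fun j => j != i) a b|.
have -> : err = fun w => G (h w) (s w).
  by apply/funext => w; rewrite /err count_sketch_err.
rewrite (expectation_avg uh us hs) ?lee_fin; last by move=> a b; exact: normr_ge0.
by split; [exact: avg_zipf_noise_lb | exact: avg_zipf_noise_ub].
Qed.
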